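(* Let $r\in\mathbb{Q}$ and let $n\geq 1$ be an integer. Suppose that $\sin^n(r\pi)$ is rational. Then \[\sin(r\pi)\in\left\{0,\ \pm 1,\ \pm\frac{1}{2},\ \pm\frac{\sqrt{3}}{2},\ \pm\frac{\sqrt{2}}{2}\right\}.\]
   Context: Here $\sin^n(r\pi)$ denotes the $n$-th power $(\sin(r\pi))^n$. *)

(* Defs.v *)
From mathcomp Require Import all_boot all_order all_algebra.
From mathcomp Require Import reals trigo.

(* Main.v *)
Require Import Defs.
From mathcomp Require Import all_boot all_order all_algebra.
From mathcomp Require Import reals trigo.
From mathcomp Require Import all_field.
From mathcomp Require Import ring lra.

(** Put [y = 2 cos (2 r pi)], so that [4 sin^2 (r pi) = 2 - y] and [(2 - y)^n]
    is a rational [c].  If [sin (2 r pi) = 0] then [y = 2] or [y = -2].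
    Otherwise [y] is a root of a Chebyshev polynomial of the second kind, whose
    roots are all real and at most 2; since [t |-> t^n] is injective on
    [t >= 0], [y] is the only root it has in common with [(2 - X)^n - c].  The
    gcd of these two rational polynomials is therefore a power of [X - y], so
    [y] is rational.  As the Chebyshev polynomial (in [2 cos]) is monic with
    integer coefficients, [y] is an integer, and [-2 <= y <= 2]. *)

Set Implicit Arguments.
Unset Strict Implicit.
Unset Printing Implicit Defensive.

Import Order.TTheory GRing.Theory Num.Theory.

Local Open Scope ring_scope.

(** The gcd is the same over [rat] and over [F]. Over [F] it is, up to a unit, a subproduct of the
    factors of [p], all equal to ['X - x%:P]. Made monic it is a power of that factor, and its
    second highest coefficient, a rational, yields [x]. *)
Lemma common_root_rat (F : numFieldType) (p q : {poly rat}) (rs : seq F) (x : F) :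
  map_poly ratr p = \prod_(z <- rs) ('X - z%:P) ->
  root (map_poly ratr p) x -> root (map_poly ratr q) x ->
  (forall z, z \in rs -> root (map_poly ratr q) z -> z = x) ->
  exists c : rat, x = ratr c.
Proof.
move=> pE px qx uniq_x.
pose g := gcdp p q.
have gE : map_poly ratr g = gcdp (map_poly ratr p) (map_poly ratr q) :> {poly F}.
  exact: gcdp_map.
have p0 : map_poly ratr p != 0 :> {poly F}.
  by rewrite pE; apply/monic_neq0/monic_prod_XsubC.
have g0 : g != 0.
  apply: contraNneq p0 => /eqP; rewrite gcdp_eq0 => /andP[/eqP-> _].
  by rewrite rmorph0.
have gx : root (map_poly ratr g) x by rewrite gE root_gcd px qx.
have := dvdp_gcdl (map_poly ratr p : {poly F}) (map_poly ratr q).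
rewrite -gE pE => /dvdp_prod_XsubC[m gm].
set s := mask m rs in gm.
have sx z : z \in s -> z = x.
  move=> zs; apply: uniq_x; first exact: mem_mask zs.
  have : root (map_poly ratr g) z by rewrite (eqp_root gm) root_prod_XsubC.
  by rewrite gE root_gcd => /andP[].
have xs : x \in s by rewrite -root_prod_XsubC -(eqp_root gm).
have s0 : size s != 0%N by move: xs; case: (s).
pose h := (lead_coef g)^-1 *: g.
have hE : map_poly ratr h = \prod_(z <- s) ('X - z%:P) :> {poly F}.
  apply/eqP; rewrite -eqp_monic ?monic_prod_XsubC //.
    rewrite /h map_polyZ /=; apply: eqp_trans gm; apply: eqp_scale.
    by rewrite fmorph_eq0 invr_eq0 lead_coef_eq0.
  by rewrite map_monic monicE lead_coefZ mulVf ?lead_coef_eq0.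
(* This coefficient is minus the sum of the roots, that is [- x] times [size s], and [size s] is
   nonzero in characteristic 0. *)
have := coefPn_prod_XsubC s0; rewrite -hE coef_map /=.
rewrite (eq_big_seq (fun=> x)) // big_const_seq count_predT iter_addr_0.
move=> hc; exists (- h`_(size s).-1 / (size s)%:R).
rewrite fmorph_div rmorphN /= hc opprK rmorph_nat.
by rewrite -[x *+ _]mulr_natr mulfK ?pnatr_eq0.
Qed.

(** Viewed in [algC], [c] is an algebraic integer that is also rational, hence an integer. *)
Lemma rat_root_int (p : {poly int}) (c : rat) :
  p \is monic -> root (map_poly intr p) c -> c \is a Num.int.
Proof.
move=> pm pc; rewrite -Cint_rat; apply: Cint_rat_Aint; first exact: Crat_rat.
apply: (@root_monic_Aint (map_poly intr p)).
- rewrite -(fmorph_root (ratr : {rmorphism rat -> algC})) -map_poly_comp in pc.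
  by rewrite (eq_map_poly (g := intr)) in pc => // z /=; rewrite ratr_int.
- exact: monic_map.
- by apply/polyOverP => i; rewrite coef_map intr_int.
Qed.

(* Chebyshev polynomials of the second kind, in the variable [2 cos x]. *)
Fixpoint chebU (R : nzRingType) (n : nat) : {poly R} :=
  match n with
  | 0 => 1
  | 1 => 'X
  | (n'.+1 as m).+1 => chebU R m * 'X - chebU R n'
  end.

Arguments chebU : simpl never.

Lemma chebUSS (R : nzRingType) n :
  chebU R n.+2 = chebU R n.+1 * 'X - chebU R n.
Proof. by []. Qed.

Lemma map_chebU (R S : nzRingType) (f : {rmorphism R -> S}) n :
  map_poly f (chebU R n) = chebU S n.
Proof.
elim/ltn_ind: n => -[|[|n]] IH; [exact: rmorph1 | exact: map_polyX |].
by rewrite !chebUSS rmorphB rmorphM /= !IH // map_polyX.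
Qed.

Lemma size_monic_chebU (R : nzRingType) n :
  size (chebU R n) = n.+1 /\ chebU R n \is monic.
Proof.
elim/ltn_ind: n => -[|[|n]] IH; first by rewrite size_poly1 monic1.
  by rewrite size_polyX monicX.
have [sz1 m1] := IH n.+1 (ltnSn _); have [sz0 _] := IH n (ltnW (ltnSn _)).
have szX : size (chebU R n.+1 * 'X) = n.+3.
  by rewrite size_mulX ?sz1 // monic_neq0.
have lt : (size (- chebU R n) < size (chebU R n.+1 * 'X)%R)%N.
  by rewrite size_polyN sz0 szX.
split; first by rewrite chebUSS size_polyDl.
by rewrite monicE chebUSS lead_coefDl // lead_coefMX.
Qed.

(** The recurrence of [chebU] matches sin(t + x) + sin(t - x) = 2 cos x sin t at t = (n + 2)x. *)
Lemma sin_chebU (R : realType) (x : R) n :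
  sin x * (chebU R n).[cos x *+ 2] = sin (x *+ n.+1).
Proof.
elim/ltn_ind: n => -[|[|n]] IH.
- by rewrite hornerE mulr1.
- by rewrite hornerX sin_mulr2n mulrnAr mulrC.
have -> : x *+ n.+3 = x *+ n.+2 + x by rewrite [LHS]mulrSr.
have E : sin (x *+ n.+1) = sin (x *+ n.+2 - x) by rewrite [x *+ n.+2]mulrSr addrK.
rewrite chebUSS hornerD hornerN hornerMX mulrBr mulrA.
by rewrite !IH ?ltnS // E sinB (sinD (x *+ n.+2)); ring.
Qed.

Lemma sin_pi_mulrn (R : realType) n : sin (pi *+ n : R) = 0.
Proof. by elim: n => [|n IH]; rewrite ?sin0 // mulrSr sinDpi IH oppr0. Qed.

Lemma sin_pi_mulrz (R : realType) (a : int) : sin (pi *~ a : R) = 0.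
Proof.
by case: a => n; rewrite ?NegzE ?mulrNz ?sinN -pmulrn sin_pi_mulrn ?oppr0.
Qed.

(** By [sin_chebU] these are roots, since the sine does not vanish on (0, pi). They are distinct
    because the cosine is injective on [0, pi], and there are as many as the degree. *)
Lemma chebU_split (R : realType) n :
  chebU R n = \prod_(z <- [seq cos (pi * k.+1%:R / n.+1%:R) *+ 2 | k <- iota 0 n])
                ('X - z%:P).
Proof.
have [sz mo] := size_monic_chebU R n.
set rs := map _ _.
have n0 : 0 < n.+1%:R :> R by rewrite ltr0n.
have itv k : (k < n)%N -> 0 < (pi : R) * k.+1%:R / n.+1%:R < pi.
  move=> kn; rewrite divr_gt0 ?mulr_gt0 ?pi_gt0 ?ltr0n //=.
  by rewrite ltr_pdivrMr // ltr_pM2l ?pi_gt0 // ltr_nat ltnS.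
rewrite [LHS](@all_roots_prod_XsubC _ _ rs).
- by rewrite (monicP mo) scale1r.
- by rewrite sz size_map size_iota.
- apply/allP => z /mapP[k]; rewrite mem_iota add0n => /= kn ->.
  have h := itv _ kn; have s0 := lt0r_neq0 (sin_gt0_pi h).
  apply/rootP/(mulfI s0); rewrite mulr0 sin_chebU -[_ / _ *+ _]mulr_natr divfK ?lt0r_neq0 //.
  by rewrite mulr_natr sin_pi_mulrn.
- rewrite uniq_rootsE map_inj_in_uniq ?iota_uniq // => j k.
  rewrite !mem_iota !add0n => /= jn kn /eqP; rewrite eqrMn2r // => /eqP.
  have /andP[j0 j1] := itv _ jn; have /andP[k0 k1] := itv _ kn.
  move/cos_inj; rewrite !in_itv /= !ltW // => /(_ isT isT).
  have ni : n.+1%:R^-1 != 0 :> R by rewrite invr_eq0 lt0r_neq0.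
  have pi0 : pi != 0 :> R by rewrite lt0r_neq0 ?pi_gt0.
  by move/(mulIf ni)/(mulfI pi0)/eqP; rewrite eqr_nat eqSS => /eqP.
Qed.

Lemma cos2_int (R : realType) (x : R) (b n : nat) (a : rat) :
  (0 < b)%N -> (0 < n)%N -> sin (x *+ b) = 0 ->
  (2 - cos x *+ 2) ^+ n = ratr a -> exists m : int, cos x *+ 2 = m%:~R.
Proof.
case: b => // b _ n0 sb ya.
(* Only for [sin x != 0] can it be cancelled in [sin_chebU] to make [cos x *+ 2] a root. *)
have [s0|s0] := eqVneq (sin x) 0.
  have := cos2Dsin2 x; rewrite s0 expr0n addr0 => /eqP.
  by rewrite sqrf_eq1 => /orP[]/eqP->; [exists 2|exists (-2)]; rewrite ?mulrNz ?mulNrn.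
have le2 (t : R) : 0 <= 2 - cos t *+ 2 by have := cos_le1 t; lra.
have Uy : root (chebU R b) (cos x *+ 2).
  by apply/rootP/(mulfI s0); rewrite sin_chebU mulr0.
pose q : {poly rat} := (2%:P - 'X) ^+ n - a%:P.
have qE (z : R) : root (map_poly ratr q) z = ((2 - z) ^+ n == ratr a).
  rewrite rmorphB rmorphXn rmorphB /= !map_polyC map_polyX /root !hornerE.
  by rewrite subr_eq0 /= rmorph_nat.
have [||||c' yE] := @common_root_rat R (chebU _ b) q
  [seq cos (pi * k.+1%:R / b.+1%:R) *+ 2 | k <- iota 0 b] (cos x *+ 2).
- by rewrite map_chebU; apply: chebU_split.
- by rewrite map_chebU.
- by rewrite qE ya.
(* Every root is a doubled cosine, so [le2] puts both bases in the range where the [n]-th power is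
   injective, even for even [n]. *)
- move=> _ /mapP[k _ ->]; rewrite qE -ya => /eqP /(pexpIrn n0).
  by rewrite !nnegrE !le2 => /(_ isT isT)/addrI/oppr_inj.
have [m mE] : exists m : int, c' = m%:~R.
  apply/intrP/(@rat_root_int (chebU int b)); first by case: (size_monic_chebU int b).
  by rewrite map_chebU -(fmorph_root (ratr : {rmorphism rat -> R})) map_chebU /= -yE.
by exists m; rewrite yE mE ratr_int.
Qed.

Theorem corollary12 (R : realType) (r : rat) (n : nat) (n_ge1 : (1 <= n)%N)
  (sinXn_rat : exists q : rat, sin (ratr r * pi) ^+ n = ratr q :> R) :
  sin (ratr r * pi : R) \in
    [:: 0; 1; - 1; 1 / 2; - (1 / 2);
        Num.sqrt 3 / 2; - (Num.sqrt 3 / 2);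
        Num.sqrt 2 / 2; - (Num.sqrt 2 / 2)].
Proof.
case: sinXn_rat => q; set x := ratr r * pi; set s := sin x => sq.
have cE : 2 - cos (x *+ 2) *+ 2 = 4 * s ^+ 2.
  by rewrite cos_mulr2n cos2sin2 -/s; ring.
have sb : sin (x *+ 2 *+ `|denq r|) = 0.
  have -> : x *+ 2 *+ `|denq r| = pi *~ (numq r * 2).
    rewrite pmulrn absz_denq /x -[LHS]mulrzr -[RHS]mulrzr /ratr.
    have d0 : (denq r)%:~R != 0 :> R by rewrite intr_eq0 denq_neq0.
    by rewrite intrM; field.
  exact: sin_pi_mulrz.
(* The lemma is used at the angle [x *+ 2]; the rational comes from (4 s^2)^n = 4^n (s^n)^2. *)
have [||m mE] := cos2_int (a := 4 ^+ n * q ^+ 2) _ n_ge1 sb.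
- by rewrite absz_gt0 denq_neq0.
- by rewrite cE exprMn exprAC sq rmorphM !rmorphXn /= rmorph_nat.
have s2 : s ^+ 2 = (2 - m%:~R) / 4 by rewrite -mE cE; field.
have sqrt2 (k : nat) : (Num.sqrt k%:R / 2) ^+ 2 = k%:R / 4 :> R.
  by rewrite expr_div_n sqr_sqrtr ?ler0n //; congr (_ / _); ring.
have sqr_eq (t : R) : s ^+ 2 = t ^+ 2 -> s = t \/ s = - t.
  by move/eqP; rewrite eqf_sqr => /orP[]/eqP; [left|right].
have : (-2 <= m <= 2)%R.
  have := cos_le1 (x *+ 2); have := cos_geN1 (x *+ 2) => h1 h2.
  by rewrite -!(ler_int R) -mE; apply/andP; split; lra.
have mem5 : m \in [:: -2; -1; 0; 1; 2] -> s \in [:: 0; 1; - 1; 1 / 2; - (1 / 2);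
        Num.sqrt 3 / 2; - (Num.sqrt 3 / 2); Num.sqrt 2 / 2; - (Num.sqrt 2 / 2)].
  (* For m = -2, -1, 0, 1, 2 the square of [s] is 1, 3/4, 1/2, 1/4, 0. *)
  rewrite !inE => /or4P[/eqP mV|/eqP mV|/eqP mV|/orP[]/eqP mV].
  - have [|->|->] := sqr_eq 1; rewrite ?eqxx ?orbT // s2 mV; lra.
  - by have [|->|->] := sqr_eq (Num.sqrt 3 / 2); rewrite ?eqxx ?orbT // s2 mV sqrt2; lra.
  - by have [|->|->] := sqr_eq (Num.sqrt 2 / 2); rewrite ?eqxx ?orbT // s2 mV sqrt2; lra.
  - by have [|->|->] := sqr_eq (1 / 2); rewrite ?eqxx ?orbT // s2 mV; lra.
  - by have [|->|->] := sqr_eq 0; rewrite ?oppr0 ?eqxx ?orbT // s2 mV; lra.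
move=> mle; apply: mem5.
by move: mle; case: m {mE s2} => [[|[|[|?]]]|[|[|?]]].
Qed.
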